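(* Let $0<A<1$ and consider the difference equation $$x_{n+1}=(x_n\cdot x_{n-1})^{\frac{1}{2}}\cdot\max\left\{\frac{1}{x_n},A\right\},\qquad n\geq 0,$$ with arbitrary positive real initial conditions $(x_{-1},x_0)$. Then: there exists a unique equilibrium point, $\bar{x}=1$; for every $x\in\left[A,\frac{1}{A}\right]$ the sequence $\left(x,\frac{1}{x},x,\frac{1}{x},\ldots\right)$ is a $2$-periodic solution (so that there is a continuum of $2$-periodic solutions); and every other solution converges to a $2$-periodic solution.
   Context: An equilibrium point is a value $\bar{x}>0$ such that the constant sequence $\bar{x}$ is a solution. The period $2$ is not required to be minimal: $x=1$ gives the constant solution, which is regarded as $2$-periodic. A solution $(x_n)_{n\geq -1}$ converges to a $2$-periodic solution $(p_n)_{n\geq -1}$ if $x_n-p_n\to 0$ as $n\to+\infty$. *)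

(* Defs.v *)
From mathcomp Require Import all_boot all_order all_algebra.
From mathcomp Require Import all_classical all_reals all_analysis.

Set Implicit Arguments.
Unset Strict Implicit.
Unset Printing Implicit Defensive.

Import Order.TTheory GRing.Theory Num.Theory.
Import numFieldNormedType.Exports.

Local Open Scope classical_set_scope.
Local Open Scope ring_scope.

(* Sequences (x_n)_{n >= -1} are represented with the index shifted by one:
   the value of [x : nat -> R] at n is x_{n-1}, so that [x 0] and [x 1] are
   the initial conditions x_{-1} and x_0. *)

(* Only the initial conditions are required to be positive; positivity of the
   other terms is a consequence of the recurrence when 0 < A. *)
Definition solution (R : realType) (A : R) (x : nat -> R) : Prop :=
  [/\ 0 < x 0%N, 0 < x 1%N &
      forall n : nat,
        x n.+2 = (x n.+1 * x n) `^ (1 / 2) * Num.max (1 / x n.+1) A].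

Definition equilibrium (R : realType) (A c : R) : Prop :=
  0 < c /\ solution A (fun _ : nat => c).

(* The period 2 need not be minimal. *)
Definition two_periodic (R : realType) (x : nat -> R) : Prop :=
  forall n : nat, x n.+2 = x n.

Definition two_periodic_solution (R : realType) (A : R) (x : nat -> R) : Prop :=
  solution A x /\ two_periodic x.

Definition reciprocal_cycle (R : realType) (c : R) : nat -> R :=
  fun n : nat => if odd n then 1 / c else c.

Definition converges_to (R : realType) (x p : nat -> R) : Prop :=
  (fun n : nat => x n - p n) @ \oo --> (0 : R).

(* Main.v *)
(* Put y = ln x and L = - ln A > 0. The recurrence becomes
     y_{n+1} = (y_n + y_{n-1}) / 2 + max (- y_n, - L),
   so that the sums d_n = y_n + y_{n-1} satisfy d_{n+1} = d_n / 2 + e_n with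
   e_n = max (0, y_n - L) >= 0. If every d_n is negative, then y is
   nondecreasing along both parities and bounded above. Otherwise d_n >= 0 from
   some index on, which forces y_n >= - L; then e_n + e_{n-1} / 2 is a Lyapunov
   function that decreases at each step by a fixed multiple of e_n. Hence the
   series of the e_n converges and, since y_{n+1} - y_{n-1} <= e_n, subtracting
   its partial sums from y leaves a sequence that is nonincreasing along both
   parities and bounded below. *)

Require Import Defs.
From mathcomp Require Import all_boot all_order all_algebra.
From mathcomp Require Import all_classical all_reals all_analysis.
From mathcomp Require Import lra.

Set Implicit Arguments.
Unset Strict Implicit.
Unset Printing Implicit Defensive.

Import Order.TTheory GRing.Theory Num.Theory.
Import numFieldNormedType.Exports.

Local Open Scope classical_set_scope.
Local Open Scope ring_scope.

(** * Asymptotically 2-periodic sequences *)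

Lemma two_periodic_double (R : realType) (p : nat -> R) (n k : nat) :
  two_periodic p -> p (n + k.*2)%N = p n.
Proof.
by move=> pP; elim: k => [|k IHk]; rewrite ?addn0 // doubleS !addnS pP.
Qed.

(** Reduces the convergence to ordinary limits along steps of two, to which monotone convergence and
    the limit laws apply. *)
Lemma converges_toP (R : realType) (x p : nat -> R) : two_periodic p ->
  converges_to x p <-> forall n, (fun k => x (n + k.*2)%N) @ \oo --> p n.
Proof.
move=> pP; split=> [xp n | xp].
- apply/cvgrPdist_lt => e e0.
  have /cvgrPdist_lt/(_ e e0)[N _ xpN] := xp.
  exists N => // k Nk.
  have /xpN : (N <= n + k.*2)%N.
    by rewrite (leq_trans Nk)// -addnn addnA leq_addl.
  by rewrite /= (two_periodic_double _ _ pP) sub0r normrN distrC.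
- apply/cvgrPdist_lt => e e0.
  have /cvgrPdist_lt/(_ e e0)[N0 _ xpN0] := xp 0%N.
  have /cvgrPdist_lt/(_ e e0)[N1 _ xpN1] := xp 1%N.
  exists (maxn N0 N1).*2.+1 => // n /= Nn.
  have : (maxn N0 N1 <= n./2)%N.
    by rewrite -(doubleK (maxn N0 N1)) half_leq// ltnW.
  rewrite geq_max => /andP[/xpN0 h0 /xpN1 h1].
  rewrite sub0r normrN distrC -(odd_double_half n) (two_periodic_double _ _ pP).
  by case: (odd n).
Qed.

(** Nothing is asked of [p] beyond periodicity; that it solves the equation is recovered later by
    [log_solution_limit]. *)
Definition asymptotically_two_periodic (R : realType) (x : nat -> R) : Prop :=
  exists2 p : nat -> R, two_periodic p & converges_to x p.

Lemma asymptotically_two_periodicS (R : realType) (x : nat -> R) :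
  asymptotically_two_periodic (fun n => x n.+1) -> asymptotically_two_periodic x.
Proof.
move=> [p pP xp]; exists (fun n => p n.+1) => [n|]; first exact: pP.
rewrite /converges_to -cvg_shiftS /=.
by under eq_fun do rewrite pP.
Qed.

Lemma asymptotically_two_periodicD (R : realType) (x y : nat -> R) :
  asymptotically_two_periodic x -> asymptotically_two_periodic y ->
  asymptotically_two_periodic (fun n => x n + y n).
Proof.
move=> [p pP xp] [q qP yq]; exists (fun n => p n + q n) => [n|].
  by rewrite pP qP.
rewrite /converges_to -[0 in X in _ --> X]addr0.
under eq_fun do rewrite opprD addrACA.
exact: cvgD.
Qed.

Lemma asymptotically_two_periodicN (R : realType) (x : nat -> R) :
  asymptotically_two_periodic (fun n => - x n) -> asymptotically_two_periodic x.
Proof.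
move=> [p pP xp]; exists (fun n => - p n) => [n|]; first by rewrite pP.
rewrite /converges_to -[0 in X in _ --> X]oppr0.
under eq_fun do rewrite -[x _]opprK -opprD.
exact: cvgN.
Qed.

Lemma cvg_asymptotically_two_periodic (R : realType) (x : nat -> R) :
  cvgn x -> asymptotically_two_periodic x.
Proof.
move=> /cvg_ex[l xl]; exists (fun=> l) => //.
by rewrite /converges_to -(subrr l); apply: cvgB => //; exact: cvg_cst.
Qed.

Lemma nonincreasing2_asymptotically_two_periodic (R : realType) (x : nat -> R)
    (m : R) : (forall n, x n.+2 <= x n) -> (forall n, m <= x n) ->
  asymptotically_two_periodic x.
Proof.
move=> x_decr x_ge.
have x_cvg n : cvgn (fun k => x (n + k.*2)%N).
  apply: nonincreasing_is_cvgn; last by exists m => _ [k _ <-].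
  by apply/nonincreasing_seqP => k; rewrite doubleS !addnS.
have pP : two_periodic (fun n => limn (fun k => x (n + k.*2)%N)).
  move=> n; apply: cvg_lim => //.
  rewrite (_ : (fun k => _) = [sequence x (n + k.+1.*2)%N]_k).
    by rewrite (cvg_shiftS (fun k => x (n + k.*2)%N)); exact: x_cvg.
  by apply/funext => k /=; rewrite doubleS !addnS.
exists (fun n => limn (fun k => x (n + k.*2)%N)) => //.
by apply/converges_toP => // n; exact: x_cvg.
Qed.

(** * The equation in logarithmic form *)

Definition log_solution (R : realType) (L : R) (y : nat -> R) : Prop :=
  forall n, y n.+2 = (y n.+1 + y n) / 2 + Num.max (- y n.+1) (- L).

Lemma solution_expR (R : realType) (L : R) (y : nat -> R) :
  solution (expR (- L)) (fun n => expR (y n)) <-> log_solution L y.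
Proof.
have stepE u v : (expR u * expR v) `^ (1 / 2) * Num.max (1 / expR u) (expR (- L))
    = expR ((u + v) / 2 + Num.max (- u) (- L)).
  rewrite -expRD -expRM !div1r -expRN expRD; congr (_ * _).
  by case: (leP (- u) (- L)) => h; [apply/max_r|apply/max_l];
    rewrite ler_expR // ltW.
split=> [[_ _ yE] n|yE]; first by apply: expR_inj; rewrite yE stepE.
by split=> [||n]; rewrite ?expR_gt0// stepE yE.
Qed.

Lemma solution_gt0 (R : realType) (A : R) (x : nat -> R) :
  0 < A -> solution A x -> forall n, 0 < x n.
Proof.
move=> A0 [x0 x1 xE] n.
suff /andP[] : (0 < x n) && (0 < x n.+1) by [].
elim: n => [|n /andP[xn xn1]]; first by rewrite x0 x1.
rewrite xn1 xE mulr_gt0 ?powR_gt0 ?mulr_gt0//.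
by rewrite lt_max A0 orbT.
Qed.

Lemma solution_expR_ln (R : realType) (A : R) (x : nat -> R) : 0 < A ->
  solution A x ->
  x = (fun n => expR (ln (x n))) /\ log_solution (- ln A) (fun n => ln (x n)).
Proof.
move=> A0 xA.
have xE : x = (fun n => expR (ln (x n))).
  by apply/funext => n; rewrite lnK// posrE (@solution_gt0 _ A).
split=> //; apply/solution_expR.
by rewrite opprK lnK ?posrE// -xE.
Qed.

(** Adding the equations for two consecutive indices gives max (- y 0, - L) + max (- y 1, - L) = 0.
    Both maxima equal to - L is impossible as 0 < L, and a mixed case forces the values L and -
    L. *)
Lemma log_solution_two_periodic_opp (R : realType) (L : R) (y : nat -> R) :
  0 < L -> log_solution L y -> two_periodic y -> y 1%N = - y 0%N.
Proof.
move=> L0 yL yP; have := yL 0%N; have := yL 1%N; rewrite !yP.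
by case: leP => h1; case: leP => h2; lra.
Qed.

Lemma log_solutionS (R : realType) (L : R) (y : nat -> R) :
  log_solution L y -> log_solution L (fun n => y n.+1).
Proof. by move=> yL n; exact: yL. Qed.

Lemma log_solution_limit (R : realType) (L : R) (y p : nat -> R) :
  log_solution L y -> two_periodic p -> converges_to y p -> log_solution L p.
Proof.
move=> yL pP /converges_toP-/(_ pP) yp n.
apply: (cvg_unique _ (yp n.+2)) => //.
(* Written with an absolute value, the maximum is covered by the limit laws for sums, products and
   norms. *)
rewrite maxr_absE.
under [X in X @ _]eq_fun do rewrite !addSn yL -addSn maxr_absE.
apply: cvgD; apply: cvgM; try exact: cvg_cst; first exact: cvgD.
apply: cvgD; first by apply: cvgD; [exact: cvgN|exact: cvg_cst].
by apply: cvg_norm; apply: cvgB; [exact: cvgN|exact: cvg_cst].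
Qed.

(** * Convergence of logarithmic solutions *)

Section LogConvergence.
Variables (R : realType) (L : R).
Hypothesis L_gt0 : 0 < L.
Implicit Type y : nat -> R.

Let excess (u : R) : R := Num.max 0 (u - L).

Lemma excess_cases (u : R) :
  u <= L /\ excess u = 0 \/ L < u /\ excess u = u - L.
Proof.
rewrite /excess; have [uL|uL] := leP u L; [left|right]; split=> //.
- by apply/max_l; rewrite subr_le0.
- by apply/max_r; rewrite subr_ge0 ltW.
Qed.

Lemma excess_ge0 (u : R) : 0 <= excess u. Proof. by rewrite le_max lexx. Qed.

Lemma log_solution_sumE y n : log_solution L y ->
  y n.+1 + y n.+2 = (y n + y n.+1) / 2 + excess (y n.+1).
Proof.
move=> ->; have [[yL ->]|[Ly ->]] := excess_cases (y n.+1).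
- by rewrite max_l ?lerN2//; lra.
- by rewrite max_r ?lerN2 ?ltW//; lra.
Qed.

Lemma log_solution_ge_cvg y : log_solution L y ->
  (forall n, 0 <= y n + y n.+1) -> (forall n, - L <= y n) ->
  asymptotically_two_periodic y.
Proof.
move=> yL d_ge0 y_ge.
(* The sum starts at [y 1] because y (n+2) - y n <= excess (y (n+1)), which is the increment of [E]
   from n to n+1. *)
pose E n := \sum_(k < n) excess (y k.+1).
pose V n := excess (y n.+1) + excess (y n) / 2.
have V_ge0 n : 0 <= V n by rewrite addr_ge0 ?divr_ge0 ?excess_ge0.
(* The drop by L holds when y (n+1) and y (n+2) both exceed L. If only y (n+2) does, the bound - L
   <= y (n+1) gives excess (y (n+2)) <= excess (y n) / 2. *)
have V_step n : V n.+1 <= V n - excess (y n.+1) / 2 \/ V n.+1 <= V n - L.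
  rewrite /V; have := log_solution_sumE n yL.
  have := y_ge n; have := y_ge n.+1; have := d_ge0 n; have := excess_ge0 (y n).
  have [|] := excess_cases (y n); have [|] := excess_cases (y n.+1);
    have [|] := excess_cases (y n.+2) => -[? ->] [? ->] [? ->]; move: L_gt0;
    by [left; lra | right; lra].
(* Since M >= 2 L and M >= V n >= excess (y n.+1), both cases of V_step give
   M * V n.+1 <= M * V n - L * excess (y n.+1). *)
pose M := 2 * L + V 0%N.
have M_gt0 : 0 < M by rewrite ltr_wpDr// mulr_gt0.
have V_sum n : M * V n <= M * V 0%N - L * E n.
  have := V_ge0 0%N => V0.
  elim: n => [|n IHn]; first by rewrite /E big_ord0 mulr0 subr0.
  have E_ge0 : 0 <= E n by apply: sumr_ge0 => k _; exact: excess_ge0.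
  have E_S : E n.+1 = E n + excess (y n.+1) by rewrite /E big_ord_recr.
  (* The induction hypothesis already contains this bound, since L * E n >= 0. *)
  have V_n : V n <= V 0%N.
    have : M * V n <= M * V 0%N by have := mulr_ge0 (ltW L_gt0) E_ge0; lra.
    by rewrite ler_pM2l.
  have e_le : excess (y n.+1) <= V n by rewrite lerDl divr_ge0 ?excess_ge0.
  rewrite E_S (mulrDr L).
  case: (V_step n); rewrite -(ler_pM2l M_gt0) mulrBr => MV.
    have : 2 * L * excess (y n.+1) <= M * excess (y n.+1).
      by rewrite ler_wpM2r ?excess_ge0// lerDl.
    by lra.
  have : L * excess (y n.+1) <= L * M.
    by rewrite ler_pM2l// (le_trans e_le)// (le_trans V_n)// lerDr mulr_ge0 ?ltW.
  by lra.
have [B E_le] : exists B, forall n, E n <= B.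
  exists (M * V 0%N / L) => n.
  rewrite ler_pdivlMr// mulrC.
  by have := V_sum n; have := mulr_ge0 (ltW M_gt0) (V_ge0 n); lra.
have E_cvg : cvgn E.
  apply: nondecreasing_is_cvgn; last by exists B => _ [n _ <-].
  by apply/nondecreasing_seqP => n; rewrite /E big_ord_recr /= lerDl excess_ge0.
have yE_cvg : asymptotically_two_periodic (fun n => y n - E n).
  apply: (@nonincreasing2_asymptotically_two_periodic _ _ (- L - B)) => n.
    rewrite /E !big_ord_recr /= -/(E n).
    have := log_solution_sumE n yL.
    by have := excess_ge0 (y n.+2); have := d_ge0 n; lra.
  by have := y_ge n; have := E_le n; lra.
have := asymptotically_two_periodicD yE_cvg (cvg_asymptotically_two_periodic E_cvg).
by under eq_fun do rewrite subrK.
Qed.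

Lemma log_solution_sum_ge0 y : log_solution L y -> 0 <= y 0%N + y 1%N ->
  forall n, 0 <= y n + y n.+1.
Proof.
move=> yL d0; elim=> [//|n IHn]; rewrite log_solution_sumE//.
by rewrite addr_ge0 ?divr_ge0 ?excess_ge0.
Qed.

Lemma log_solution_sum_ge0_cvg y : log_solution L y -> 0 <= y 0%N + y 1%N ->
  asymptotically_two_periodic y.
Proof.
move=> yL /(log_solution_sum_ge0 yL) d_ge0.
(* The initial values may lie below - L; from index 2 on, each term is half a nonnegative sum plus a
   maximum that is at least - L. *)
do 2 apply: asymptotically_two_periodicS.
apply: log_solution_ge_cvg => [n|n|n]; [exact: yL|exact: d_ge0|].
have : - L <= Num.max (- y n.+1) (- L) by rewrite le_max lexx orbT.
by rewrite yL; have := d_ge0 n; lra.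
Qed.

Lemma log_solution_sum_lt0_cvg y : log_solution L y ->
  (forall n, y n + y n.+1 < 0) -> asymptotically_two_periodic y.
Proof.
move=> yL d_lt0.
have y_incr n : y n <= y n.+2.
  have := log_solution_sumE n yL; have := excess_ge0 (y n.+1).
  by have := d_lt0 n; lra.
apply: asymptotically_two_periodicN.
apply: (@nonincreasing2_asymptotically_two_periodic _ _
  (Num.min (y 0%N) (y 1%N))) => n; first by rewrite lerN2.
(* A lower bound on y (n+1) bounds y n from above, because their sum is negative. *)
suff /andP[_ y_ge] : (Num.min (y 0%N) (y 1%N) <= y n) &&
    (Num.min (y 0%N) (y 1%N) <= y n.+1) by have := d_lt0 n; lra.
elim: n => [|n /andP[h0 h1]]; first by rewrite !ge_min !lexx orbT.
by rewrite h1 (le_trans h0).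
Qed.

Lemma log_solution_cvg y : log_solution L y -> asymptotically_two_periodic y.
Proof.
move=> yL.
have [[n d_ge0]|d_lt0] := pselect (exists n, 0 <= y n + y n.+1).
  elim: n y yL d_ge0 => [|n IHn] y yL d_ge0; first exact: log_solution_sum_ge0_cvg.
  by apply/asymptotically_two_periodicS/IHn => //; exact: log_solutionS.
apply: log_solution_sum_lt0_cvg => // n.
by rewrite ltNge; apply/negP => d_ge0; apply: d_lt0; exists n.
Qed.

End LogConvergence.

(** * Reciprocal cycles and 2-periodic solutions *)

(** The logarithms alternate between ln c and - ln c, both at most L = - ln A, so the maximum is
    always - y (n+1) and the recurrence becomes y (n+2) = (y n - y (n+1)) / 2. *)
Lemma reciprocal_cycle_solution (R : realType) (A c : R) : 0 < A -> A < 1 ->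
  A <= c <= 1 / A -> two_periodic_solution A (reciprocal_cycle c).
Proof.
move=> A0 A1 /andP[Ac cA].
have c0 : 0 < c by exact: lt_le_trans Ac.
split; last by move=> n; rewrite /reciprocal_cycle /= negbK.
have -> : reciprocal_cycle c =
    fun n => expR (if odd n then - ln c else ln c).
  apply/funext => n; rewrite /reciprocal_cycle.
  by case: odd; rewrite ?expRN lnK ?posrE// div1r.
rewrite -{1}(@lnK _ A) ?posrE// -[ln A]opprK; apply/solution_expR => n /=.
have lnAc : ln A <= ln c by rewrite ler_ln ?posrE.
have lncA : ln c <= - ln A.
  by rewrite -lnV ?posrE// ler_ln ?posrE ?invr_gt0// -div1r.
by rewrite negbK; case: odd => /=; case: leP => ?; lra.
Qed.

Lemma two_periodic_solution_reciprocal (R : realType) (A : R) (p : nat -> R) :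
  0 < A -> A < 1 -> two_periodic_solution A p -> p = reciprocal_cycle (p 0%N).
Proof.
move=> A0 A1 [pA pP].
have [pE pL] := solution_expR_ln A0 pA.
have p1 : p 1%N = 1 / p 0%N.
  rewrite div1r [in LHS]pE (@log_solution_two_periodic_opp _ _ _ _ pL).
  - by rewrite expRN lnK// posrE (@solution_gt0 _ A).
  - by rewrite oppr_gt0 ln_lt0// A0.
  - by move=> n; rewrite pP.
apply/funext => n; rewrite -[n in LHS]odd_double_half two_periodic_double//.
by rewrite /reciprocal_cycle; case: odd.
Qed.

Theorem corollary4 (R : realType) (A : R) (A_gt0 : 0 < A) (A_lt1 : A < 1) :
  [/\ unique (equilibrium A) 1,
      forall c : R, A <= c <= 1 / A -> two_periodic_solution A (reciprocal_cycle c),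
      ([set p : nat -> R | two_periodic_solution A p] #= [set: R])%card &
      forall x : nat -> R, solution A x ->
        ~ (exists2 c : R, A <= c <= 1 / A & x = reciprocal_cycle c) ->
        exists2 p : nat -> R, two_periodic_solution A p & converges_to x p].
Proof.
have L_gt0 : 0 < - ln A by rewrite oppr_gt0 ln_lt0// A_gt0.
split.
- split.
    split=> //.
    rewrite (_ : (fun=> 1) = reciprocal_cycle 1); last first.
      by apply/funext => n; rewrite /reciprocal_cycle divr1 if_same.
    have /(reciprocal_cycle_solution A_gt0 A_lt1)[] // : A <= 1 <= 1 / A.
      by rewrite ltW// ler_pdivlMr// mul1r ltW.
  move=> c [c0 cA].
  (* A constant solution is 2-periodic, hence a reciprocal cycle; its value at index 1 gives c = 1 /
     c. *)
  have /(congr1 (fun p => p 1%N)) :=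
    @two_periodic_solution_reciprocal _ _ (fun=> c) A_gt0 A_lt1 (conj cA (fun=> erefl)).
  rewrite /reciprocal_cycle /= div1r => cV.
  have /eqP : c ^+ 2 = 1 by rewrite expr2 {1}cV mulVf// gt_eqF.
  by rewrite sqrp_eq1 ?ltW// => /eqP.
- by move=> c; exact: reciprocal_cycle_solution.
(* One injection evaluates a 2-periodic solution at index 0, which determines it; the other sends
   reals to cycles. *)
- apply: Cantor_Bernstein.
    apply/pcard_injP; exists (fun p => p 0%N) => p q /set_mem pA /set_mem qA pq.
    rewrite (two_periodic_solution_reciprocal A_gt0 A_lt1 pA) pq.
    by rewrite -(two_periodic_solution_reciprocal A_gt0 A_lt1 qA).
  (* [contract] maps the reals injectively into [-1, 1], so the exponent stays between ln A and - ln
     A. *)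
  pose f (r : R) := reciprocal_cycle (expR (- ln A * contract r%:E)).
  have f_inj : {in [set: R] &, injective f}.
    move=> r s _ _ /(congr1 (fun p => p 0%N)) /expR_inj.
    by move/(mulfI (lt0r_neq0 L_gt0))/contract_inj => -[].
  have := inj_card_eq f_inj; rewrite card_eq_le => /andP[_ /card_le_trans].
  apply; apply: subset_card_le.
  move=> _ [r _ <-]; apply: reciprocal_cycle_solution => //.
  have := contract_le1 r%:E; rewrite ler_norml => /andP[r_ge r_le].
  rewrite div1r -{1 4}(@lnK _ A) ?posrE// -expRN !ler_expR.
  by apply/andP; split; nra.
- move=> x xA _.
  have [xE xL] := solution_expR_ln A_gt0 xA.
  (* The limit is found for the logarithms and carried back by continuity of [expR]. *)
  have [q qP xq] := log_solution_cvg L_gt0 xL.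
  have qL := log_solution_limit xL qP xq.
  have pP : two_periodic (fun n => expR (q n)) by move=> n; rewrite qP.
  exists (fun n => expR (q n)).
    by split=> //; have /solution_expR := qL; rewrite opprK lnK ?posrE.
  rewrite xE; apply/converges_toP => // n.
  move/converges_toP: xq => /(_ qP n).
  exact: (continuous_cvg _ (@continuous_expR _ _)).
Qed.
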